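(* Let $\mathcal S$ be a semigroup of $d\times d$ matrices with nonnegative entries, and let a permutation of the canonical basis of $\mathbb R^d$ be chosen after which all $A\in\mathcal S$ have the block upper triangular form $$A=\begin{pmatrix}A^{(1)} & * & \cdots & *\\ 0 & A^{(2)} & * & \vdots\\ \vdots & & \ddots & *\\ 0&\cdots&0&A^{(s)}\end{pmatrix}$$ with square diagonal blocks whose locations and sizes $d^{(1)},\dots,d^{(s)}$ ($\sum_i d^{(i)}=d$) do not depend on $A\in\mathcal S$, and such that for each $i$ the semigroup $\mathcal S^{(i)}=\{A^{(i)}: A\in\mathcal S\}$ is positively irreducible. Then $\mathcal S$ is c.s.r. if and only if there is an index $j$ such that $\mathcal S^{(j)}$ is c.s.r. and $\rho(\mathcal S^{(i)})\le 1$ for all $i\neq j$.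
   Context: Matrix semigroups are multiplicative; the paper considers semigroups $\mathcal S$ that are topologically closed. The spectral radius is the maximal modulus of eigenvalues. A matrix semigroup is c.s.r. (has constant spectral radius) if the spectral radius of all its elements is the same and nonzero. A coordinate subspace of $\mathbb R^d$ is a subspace spanned by $p$ vectors of the canonical basis, $1\le p\le d-1$. A family of nonnegative matrices is positively reducible if all its matrices share a common invariant coordinate subspace; otherwise it is positively irreducible. A permutation as in the claim always exists; if $\mathcal S$ is positively irreducible, then $s=1$, $\mathcal S^{(1)}=\mathcal S$. The joint spectral radius of a bounded matrix family $\mathcal M$ is $\rho(\mathcal M)=\lim_{k\to\infty}\sup\{\|M_k\cdots M_1\|^{1/k}: M_1,\dots,M_k\in\mathcal M\}$; the condition $\rho(\mathcal S^{(i)})\le 1$ includes that $\mathcal S^{(i)}$ is bounded. *)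

(* Defs.v *)
From HB Require Import structures.
From mathcomp Require Import all_boot all_order all_algebra perm.
From mathcomp Require Import complex.
From mathcomp Require Import all_classical all_reals all_analysis.

Set Implicit Arguments.
Unset Strict Implicit.
Unset Printing Implicit Defensive.

Import Order.TTheory GRing.Theory Num.Theory numFieldNormedType.Exports.

Local Open Scope classical_set_scope.
Local Open Scope ring_scope.
Local Open Scope complex_scope.

Definition matrix_semigroup (R : realType) (n : nat) (S : set 'M[R]_n) : Prop :=
  S !=set0 /\ (forall A B, S A -> S B -> S (A *m B)).

Definition nonneg_family (R : realType) (n : nat) (S : set 'M[R]_n) : Prop :=
  forall A, S A -> forall i j, 0 <= A i j.

(* For n > 0 the set of moduli is finite and nonempty, so [sup] is a maximum. *)
Definition spectral_radius (R : realType) (n : nat) (A : 'M[R]_n) : R :=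
  sup [set complex.Re `|z| | z in
        [set z : R[i] | eigenvalue (map_mx (real_complex R) A) z]].

Definition csr (R : realType) (n : nat) (S : set 'M[R]_n) : Prop :=
  exists r : R, r != 0 /\ forall A, S A -> spectral_radius A = r.

Definition coordinate_subspace (R : realType) (n : nat) (I : {set 'I_n}) :
    {vspace 'cV[R]_n} :=
  <<[seq (delta_mx k 0)%R | k <- enum I]>>%VS.

Definition positively_reducible (R : realType) (n : nat) (S : set 'M[R]_n) :
    Prop :=
  exists I : {set 'I_n}, (1 <= #|I| <= n.-1)%N /\
    forall A, S A -> forall v : 'cV[R]_n,
      v \in coordinate_subspace R I -> A *m v \in coordinate_subspace R I.

Definition positively_irreducible (R : realType) (n : nat) (S : set 'M[R]_n) :
    Prop :=
  ~ positively_reducible S.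

(* The norm [`|_|] is the entrywise maximum norm; since all norms on matrices
   are equivalent, the limit does not depend on this choice.  For a nonempty
   bounded family the sequence converges (Fekete's lemma), so [limn] is then a
   genuine limit. *)
Definition joint_spectral_radius (R : realType) (n : nat) (S : set 'M[R]_n) :
    \bar R :=
  limn (fun k : nat =>
    ereal_sup [set ((`|\prod_(i < k) M i : 'M[R]_n| `^ k%:R^-1)%:E)
              | M in [set M : 'I_k -> 'M[R]_n | forall i, S (M i)]]).

(* Boundedness is separate because the limit alone may be small for an unbounded
   family, as for [{t E_12 : t >= 0}]. *)
Definition jsr_le1 (R : realType) (n : nat) (S : set 'M[R]_n) : Prop :=
  bounded_set S /\ (joint_spectral_radius S <= 1)%E.

(* [s] permutes the canonical basis: entry (i, j) of the reindexed matrix is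
   [A (s i) (s j)].  The cast only lets [submxblock] see the block sizes. *)
Definition permuted (R : realType) (d s : nat) (p : 'I_s -> nat)
    (hd : (\sum_(i < s) p i)%N = d) (sigma : 'S_d) (A : 'M[R]_d) :
    'M[R]_(\sum_(i < s) p i) :=
  castmx (esym hd, esym hd) (row_perm sigma (col_perm sigma A)).

Definition block_upper_triangular (R : realType) (s : nat) (p : 'I_s -> nat)
    (A : 'M[R]_(\sum_(i < s) p i)) : Prop :=
  forall i j : 'I_s, (j < i)%N -> submxblock A i j = 0.

Definition diag_block_family (R : realType) (d s : nat) (p : 'I_s -> nat)
    (hd : (\sum_(i < s) p i)%N = d) (sigma : 'S_d) (S : set 'M[R]_d)
    (i : 'I_s) : set 'M[R]_(p i) :=
  [set submxblock (permuted hd sigma A) i i | A in S].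
Arguments diag_block_family {R d s p} hd sigma S i _.

(* Main.v *)
Require Import Defs.
From HB Require Import structures.
From mathcomp Require Import all_boot all_order all_algebra perm.
From mathcomp Require Import complex.
From mathcomp Require Import all_classical all_reals all_analysis.
From mathcomp Require Import ring.

(** If S is c.s.r., its spectral radius is 1 (consider powers), so every diagonal
    block has spectral radius at most 1; together with irreducibility this bounds
    each block semigroup.  If every block j had some A_j in S whose j-th block
    has spectral radius less than 1, then for large n all diagonal blocks of
    A_1^n ... A_s^n would be small, since the j-th one has a small factor and
    bounded other factors; this contradicts spectral radius 1.  Conversely, in a
    bounded semigroup the spectral radius is at most 1, and the spectral radius
    of a block triangular matrix is the maximum over its diagonal blocks. *)

Set Implicit Arguments.
Unset Strict Implicit.
Unset Printing Implicit Defensive.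

Import Order.TTheory GRing.Theory Num.Theory numFieldNormedType.Exports.

Local Open Scope classical_set_scope.
Local Open Scope ring_scope.

Local Notation cmod z := (complex.Re `|z|).
Local Notation complexify A := (map_mx (real_complex _) A).

Lemma cmodE (R : realType) (z : R[i]) : (cmod z)%:C%C = `|z|.
Proof. by apply/eqP; rewrite eq_complex /= !eqxx. Qed.

Lemma cmod_ge0 (R : realType) (z : R[i]) : 0 <= cmod z.
Proof. by rewrite -lecR cmodE; exact: normr_ge0. Qed.

Lemma cmodM (R : realType) (x y : R[i]) : cmod (x * y) = cmod x * cmod y.
Proof. by apply: complexI; rewrite rmorphM /= !cmodE normrM. Qed.

Lemma cmodX (R : realType) (x : R[i]) k : cmod (x ^+ k) = cmod x ^+ k.
Proof. by apply: complexI; rewrite rmorphXn /= !cmodE normrX. Qed.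

Lemma cmodD (R : realType) (x y : R[i]) : cmod (x + y) <= cmod x + cmod y.
Proof. by rewrite -lecR rmorphD /= !cmodE ler_normD. Qed.

Lemma cmod_real (R : realType) (x : R) : cmod (x%:C)%C = `|x|.
Proof. by rewrite normc_def /= expr0n /= addr0 sqrtr_sqr. Qed.

Lemma cmod_gt0 (R : realType) (z : R[i]) : (0 < cmod z) = (z != 0).
Proof. by rewrite -ltcR cmodE -normr_gt0. Qed.

Lemma cmod_sum (R : realType) n (F : 'I_n -> R[i]) :
  cmod (\sum_i F i) <= \sum_i cmod (F i).
Proof.
elim/big_ind2: _ => [|x u y v xu yv|//].
  by rewrite normr0.
by apply: le_trans (cmodD _ _) (lerD xu yv).
Qed.

Lemma cvg0_le (R : realType) (u v : nat -> R) :
  (forall k, `|u k| <= v k) -> v @ \oo --> 0 -> u @ \oo --> 0.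
Proof.
move=> uv v0; apply/cvgr0Pnorm_le => e e0.
move/cvgr0Pnorm_le : v0 => /(_ _ e0); apply: filterS => k.
by apply: le_trans; apply: le_trans (uv k) (ler_norm _).
Qed.

Lemma cvg0_contraction (R : realType) (q : R) (u e : nat -> R) :
  0 <= q -> q < 1 -> (forall k, 0 <= u k) ->
  (forall k, u k.+1 <= q * u k + e k) -> e @ \oo --> 0 -> u @ \oo --> 0.
Proof.
move=> q0 q1 u0 urec e0; apply/cvgr0Pnorm_le => eps eps0.
have d0 : 0 < 1 - q by rewrite subr_gt0.
have eps2 : 0 < eps / 2 by rewrite divr_gt0.
move/cvgr0Pnorm_le : e0 => /(_ (eps / 2 * (1 - q))).
rewrite mulr_gt0// => /(_ isT) [N _ eN].
have bound m : u (m + N)%N <= q ^+ m * u N + eps / 2.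
  elim: m => [|m IH]; first by rewrite expr0 mul1r lerDl ltW.
  apply: le_trans (urec _) _.
  have /(le_trans (ler_norm _)) em := eN (m + N)%N (leq_addl _ _).
  apply: le_trans (lerD (ler_wpM2l q0 IH) em) _.
  by rewrite le_eqVlt; apply/orP; left; apply/eqP; rewrite exprS; ring.
have : (fun m => q ^+ m * u N) @ \oo --> (0 : R).
  rewrite -(mul0r (u N)); apply: cvgMl.
  by apply: cvg_expr; rewrite ger0_norm.
move/cvgr0Pnorm_le => /(_ _ eps2) [M _ uM].
exists (M + N)%N => //= k /= MNk.
have Nk : (N <= k)%N by apply: leq_trans MNk; exact: leq_addl.
rewrite ger0_norm// -(subnK Nk); apply: le_trans (bound _) _.
rewrite [leRHS]splitr lerD2r; apply: le_trans (ler_norm _) (uM _ _) => /=.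
by rewrite leq_subRL// addnC.
Qed.

Lemma mulmx_entry_le (R : realType) (n : nat) (A B : 'M[R]_n) a b :
  (forall i j, `|A i j| <= a) -> (forall i j, `|B i j| <= b) ->
  forall i j, `|(A *m B) i j| <= n%:R * (a * b).
Proof.
move=> Aa Bb i j; rewrite mxE; apply: le_trans (ler_norm_sum _ _ _) _.
apply: (@le_trans _ _ (\sum_(k < n) a * b)).
  by apply: ler_sum => k _; rewrite normrM ler_pM.
by rewrite sumr_const card_ord mulr_natl.
Qed.

Lemma eigenvalue_le (R : realType) (n : nat) (A : 'M[R]_n) (z : R[i]) e :
  (forall i j, `|A i j| <= e) -> eigenvalue (complexify A) z ->
  cmod z <= n%:R * e.
Proof.
move=> Ae /eigenvalueP[v vA vn0].
have [j0 vj0] : exists j, v 0 j != 0 by apply/rV0Pn.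
have [j _ jmax] := @Order.TotalTheory.arg_maxP _ R 'I_n j0 predT (fun j => cmod (v 0 j)) isT.
have vj : 0 < cmod (v 0 j) by apply: lt_le_trans (jmax j0 isT); rewrite cmod_gt0.
move/rowP : vA => /(_ j); rewrite !mxE => /(congr1 (fun x => cmod x)).
rewrite cmodM => vA; rewrite -(ler_pM2r vj) -vA.
apply: le_trans (cmod_sum _) _.
apply: (@le_trans _ _ (\sum_(k < n) e * cmod (v 0 j))).
  apply: ler_sum => k _; rewrite cmodM mxE cmod_real mulrC.
  by apply: ler_pM (Ae _ _) (jmax _ _) => //; exact: cmod_ge0.
by rewrite sumr_const card_ord -mulrA mulr_natl.
Qed.

Lemma entry_bound (R : realType) (n : nat) (A : 'M[R]_n) i j : `|A i j| <= `|A|.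
Proof.
rewrite [leRHS]/Num.norm /= mx_normrE.
by apply: (le_trans _ (le_bigmax _ _ (i, j))).
Qed.

Lemma eigenvalue_le_spectral_radius (R : realType) (n : nat) (A : 'M[R]_n) z :
  eigenvalue (complexify A) z -> cmod z <= spectral_radius A.
Proof.
move=> Az; apply: ub_le_sup; last by exists z.
exists (n%:R * `|A|) => _ [w Aw <-].
by apply: eigenvalue_le Aw => i j; exact: entry_bound.
Qed.

Lemma char_poly_roots (R : realType) (n : nat) (A : 'M[R]_n) :
  {r : seq R[i] | char_poly (complexify A) = \prod_(z <- r) ('X - z%:P)}.
Proof.
have [r rE] := closed_field_poly_normal (char_poly (complexify A)).
exists r; rewrite rE.
by rewrite (monicP (char_poly_monic _)) scale1r.
Qed.

Lemma spectral_radius_attained (R : realType) (n : nat) (A : 'M[R]_n) :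
  (0 < n)%N ->
  exists2 z, eigenvalue (complexify A) z & cmod z = spectral_radius A.
Proof.
move=> n0; have [r rE] := char_poly_roots A.
have eigE z : eigenvalue (complexify A) z = (z \in r).
  by rewrite eigenvalue_root_char rE root_prod_XsubC.
have r0 : (0 < size r)%N.
  by have := size_char_poly (complexify A); rewrite rE size_prod_XsubC => -[->].
have [i _ imax] := @Order.TotalTheory.arg_maxP _ R 'I_(size r) (Ordinal r0) predT
  (fun i => cmod (r`_i)) isT.
have ir : eigenvalue (complexify A) r`_i by rewrite eigE mem_nth.
exists (r`_i) => //; apply/eqP; rewrite eq_le.
rewrite eigenvalue_le_spectral_radius//=.
apply: ge_sup; first by exists (cmod r`_i), r`_i.
move=> _ [z /= + <-]; rewrite eigE => /(nthP 0)[k kr <-].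
exact: (imax (Ordinal kr)).
Qed.

Lemma spectral_radius_ge0 (R : realType) (n : nat) (A : 'M[R]_n) :
  (0 < n)%N -> 0 <= spectral_radius A.
Proof.
by move=> n0; have [z _ <-] := spectral_radius_attained A n0; exact: cmod_ge0.
Qed.

Lemma spectral_radius_le (R : realType) (n : nat) (A : 'M[R]_n) e :
  (0 < n)%N -> (forall i j, `|A i j| <= e) -> spectral_radius A <= n%:R * e.
Proof.
move=> n0 Ae; have [z Az <-] := spectral_radius_attained A n0.
exact: eigenvalue_le Ae Az.
Qed.

Lemma eigenvalueX (F : fieldType) (n : nat) (A : 'M[F]_n) z k :
  eigenvalue A z -> eigenvalue (A ^+ k) (z ^+ k).
Proof.
move=> /eigenvalueP[v vA v0]; apply/eigenvalueP; exists v => //.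
elim: k => [|k IH]; first by rewrite !expr0 scale1r mulmx1.
by rewrite exprS -mulmxE mulmxA vA -scalemxAl IH scalerA exprS.
Qed.

Lemma complexifyX (R : realType) (n : nat) (A : 'M[R]_n) k :
  complexify (A ^+ k) = complexify A ^+ k.
Proof.
elim: k => [|k IH]; first by rewrite !expr0 map_mx1.
by rewrite !exprS -!mulmxE map_mxM IH.
Qed.

Lemma spectral_radiusX_ge (R : realType) (n : nat) (A : 'M[R]_n) k :
  (0 < n)%N -> spectral_radius A ^+ k <= spectral_radius (A ^+ k).
Proof.
move=> n0; have [z Az <-] := spectral_radius_attained A n0.
rewrite -cmodX; apply: eigenvalue_le_spectral_radius.
by rewrite complexifyX; exact: eigenvalueX.
Qed.

(* Multiplying by one factor ['X - z] turns the decay of a sequence into that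
   of a first order recurrence with ratio [z]; Cayley-Hamilton makes the full
   product vanish. *)
Lemma powers_cvg0 (R : realType) (n : nat) (A : 'M[R]_n) i j :
  (0 < n)%N -> spectral_radius A < 1 -> (fun k => (A ^+ k) i j) @ \oo --> 0.
Proof.
case: n => // n in A i j *; move=> _ rA.
have [r rE] := char_poly_roots A.
set B := complexify A in rE.
have r1 z : z \in r -> cmod z < 1.
  move=> zr; apply: le_lt_trans rA; apply: eigenvalue_le_spectral_radius.
  by rewrite -/B eigenvalue_root_char rE root_prod_XsubC.
have : forall i j, (fun k => cmod ((B ^+ k * horner_mx B (\prod_(z <- r) ('X - z%:P))) i j))
    @ \oo --> (0 : R).
  move=> a b; rewrite -rE Cayley_Hamilton.
  rewrite [X in X @ \oo --> _](_ : _ = fun=> 0); first exact: cvg_cst.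
  by apply/funext => k; rewrite mulr0 mxE normr0.
elim: r r1 {rE} => [|z r IH] r1.
  move=> /(_ i j); apply: cvg0_le => k.
  by rewrite big_nil rmorph1 mulr1 /B -complexifyX mxE cmod_real.
rewrite big_cons rmorphM rmorphB /= horner_mx_X horner_mx_C => H.
apply: IH => [w wr|a b]; first by apply: r1; rewrite inE wr orbT.
apply: (@cvg0_contraction _ (cmod z) _ _ _ _ _ _ (H a b)).
- exact: cmod_ge0.
- by apply: r1; rewrite mem_head.
- by move=> k; exact: cmod_ge0.
move=> k; rewrite -cmodM; apply: le_trans (cmodD _ _).
set Q := horner_mx _ _.
suff -> : B ^+ k.+1 * Q = z *: (B ^+ k * Q) + B ^+ k * ((B - z%:M) * Q) by rewrite !mxE.
have zQ : z%:M * Q = z *: Q by rewrite -mulmxE mul_scalar_mx.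
rewrite exprSr -!mulrA mulrBl mulrBr zQ.
by rewrite -scalerAr addrC subrK.
Qed.

Lemma spectral_radius_lt1 (R : realType) (n : nat) (A : 'M[R]_n) :
  (0 < n)%N -> (forall i j, (fun k => (A ^+ k) i j) @ \oo --> 0) ->
  spectral_radius A < 1.
Proof.
move=> n0 A0; have e0 : 0 < (n%:R * 2)^-1 :> R by rewrite invr_gt0 mulr_gt0 ?ltr0n.
have : \forall k \near \oo, forall ij : 'I_n * 'I_n,
    `|(A ^+ k) ij.1 ij.2| <= (n%:R * 2)^-1.
  by apply: filter_forall => -[i j]; move/cvgr0Pnorm_le : (A0 i j) => /(_ _ e0).
move=> [N _ /(_ N.+1 (leqnSn N)) AN].
rewrite ltNge; apply/negP => r1.
have := spectral_radiusX_ge A N.+1 n0.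
apply/negP; rewrite -ltNge; apply: (@lt_le_trans _ _ 1); last exact: exprn_ege1.
apply: le_lt_trans (spectral_radius_le n0 (fun i j => AN (i, j))) _.
by rewrite invfM mulrA divff ?pnatr_eq0 -?lt0n// mul1r invf_lt1// ltr1n.
Qed.

Lemma spectral_radiusZ_le (R : realType) (n : nat) (A : 'M[R]_n) c :
  (0 < n)%N -> 0 < c -> spectral_radius (c *: A) <= c * spectral_radius A.
Proof.
move=> n0 c0; have [z /eigenvalueP[v vA v0] <-] := spectral_radius_attained (c *: A) n0.
have cC0 : (c%:C)%C != 0 by rewrite fmorph_eq0 gt_eqF.
have zE : z = (c%:C)%C * ((c%:C)%C^-1 * z) by rewrite mulrA divff// mul1r.
rewrite zE cmodM cmod_real gtr0_norm// ler_pM2l//.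
apply: eigenvalue_le_spectral_radius; apply/eigenvalueP; exists v => //.
apply: (scalerI cC0); rewrite scalerA -zE -vA scalemxAr; congr (v *m _).
by apply/matrixP => i j; rewrite !mxE rmorphM.
Qed.

Lemma spectral_radiusZ (R : realType) (n : nat) (A : 'M[R]_n) c :
  (0 < n)%N -> 0 < c -> spectral_radius (c *: A) = c * spectral_radius A.
Proof.
move=> n0 c0; apply/eqP; rewrite eq_le spectral_radiusZ_le//=.
have cA : c^-1 *: (c *: A) = A by rewrite scalerA mulVf ?gt_eqF// scale1r.
by rewrite -ler_pdivlMl// -{1}cA spectral_radiusZ_le// invr_gt0.
Qed.

Lemma nonneg_diag_expr (R : realType) (n : nat) (A : 'M[R]_n) a k :
  (forall i j, 0 <= A i j) ->
  (forall i j, 0 <= (A ^+ k) i j) /\ A a a ^+ k <= (A ^+ k) a a.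
Proof.
move=> A0; elim: k => [|k [IH1 IH2]].
  by split=> [i j|]; rewrite !expr0 mxE ?eqxx ?ler0n.
split=> [i j|].
  by rewrite exprS -mulmxE mxE sumr_ge0// => l _; rewrite mulr_ge0.
rewrite !exprS -mulmxE mxE (bigD1 a)//= -[leLHS]addr0 lerD//.
  by rewrite ler_wpM2l.
by rewrite sumr_ge0// => l _; rewrite mulr_ge0.
Qed.

Lemma nonneg_diag_le_spectral_radius (R : realType) (n : nat) (A : 'M[R]_n) a :
  (forall i j, 0 <= A i j) -> A a a <= spectral_radius A.
Proof.
move=> A0; have n0 : (0 < n)%N by case: n a {A A0} => [[]|].
rewrite leNgt; apply/negP => Ar.
have t0 : 0 < A a a by apply: le_lt_trans Ar; exact: spectral_radius_ge0.
set B := (A a a)^-1 *: A.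
have rB : spectral_radius B < 1.
  by rewrite spectral_radiusZ ?invr_gt0// ltr_pdivrMl// mulr1.
have B0 i j : 0 <= B i j by rewrite mxE mulr_ge0// invr_ge0 ltW.
have Baa : B a a = 1 by rewrite mxE mulVf ?gt_eqF.
have /cvgr0Pnorm_le/(_ (2^-1)) := powers_cvg0 a a n0 rB.
rewrite invr_gt0 ltr0n => /(_ isT)[N _ /(_ N (leqnn N))] /=.
have [_] := nonneg_diag_expr a N B0; rewrite Baa expr1n => B1.
move=> /(le_trans (ler_norm _))/(le_trans B1).
by rewrite leNgt invf_lt1 ?ltr1n.
Qed.

Lemma semigroupX (R : realType) (n : nat) (T : set 'M[R]_n) A k :
  matrix_semigroup T -> T A -> T (A ^+ k.+1).
Proof.
move=> [_ TM] TA; elim: k => [|k IH]; first by rewrite expr1.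
by rewrite exprS -mulmxE; exact: TM.
Qed.

Lemma semigroup_prod (R : realType) (n : nat) (T : set 'M[R]_n) k (M : 'I_k.+1 -> 'M[R]_n) :
  matrix_semigroup T -> (forall i, T (M i)) -> T (\prod_(i < k.+1) M i).
Proof.
move=> [_ TM]; elim: k M => [|k IH] M MT; first by rewrite big_ord1.
by rewrite big_ord_recl -mulmxE; apply: TM => //; exact: IH.
Qed.

Lemma csr_spectral_radius1 (R : realType) (n : nat) (T : set 'M[R]_n) :
  (0 < n)%N -> matrix_semigroup T -> csr T ->
  forall A, T A -> spectral_radius A = 1.
Proof.
move=> n0 sT [r [r0 Tr]] A TA; rewrite Tr//.
have rge0 : 0 <= r by rewrite -(Tr _ TA) spectral_radius_ge0.
apply/eqP; rewrite eq_le; apply/andP; split; rewrite leNgt; apply/negP => r1.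
  have := spectral_radiusX_ge A 2 n0.
  rewrite !Tr//; last exact: semigroupX.
  by apply/negP; rewrite -ltNge expr2 ltr_pMr// (lt_trans _ r1).
have rA : spectral_radius A < 1 by rewrite Tr.
have rn0 : 0 < r / (n%:R * 2) by rewrite divr_gt0 ?mulr_gt0 ?ltr0n// lt0r r0.
have : \forall k \near \oo, forall ij : 'I_n * 'I_n,
    `|(A ^+ k) ij.1 ij.2| <= r / (n%:R * 2).
  apply: filter_forall => -[i j].
  by move/cvgr0Pnorm_le : (powers_cvg0 i j n0 rA) => /(_ _ rn0).
move=> [N _ /(_ N.+1 (leqnSn N)) AN].
have := spectral_radius_le n0 (fun i j => AN (i, j)).
rewrite Tr; last exact: semigroupX.
have -> : n%:R * (r / (n%:R * 2)) = r / 2.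
  by field; rewrite pnatr_eq0 -lt0n.
by apply/negP; rewrite -ltNge gtr_pMr ?invf_lt1 ?ltr1n// lt0r r0.
Qed.

Lemma bounded_semigroup_spectral_radius (R : realType) (n : nat) (T : set 'M[R]_n) (C : R) :
  (0 < n)%N -> matrix_semigroup T ->
  (forall A, T A -> forall i j, `|A i j| <= C) ->
  forall A, T A -> spectral_radius A <= 1.
Proof.
move=> n0 sT TC A TA; rewrite leNgt; apply/negP => r1.
have r0 : 0 < spectral_radius A by exact: lt_trans r1.
set x := (spectral_radius A)^-1.
have x1 : `|x| < 1 by rewrite gtr0_norm ?invr_gt0// invf_lt1.
have : (fun k => x ^+ k * (n%:R * C)) @ \oo --> 0.
  by rewrite -(mul0r (n%:R * C)); apply: cvgMl; exact: cvg_expr.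
move/cvgr0Pnorm_le => /(_ (2^-1)).
rewrite invr_gt0 ltr0n => /(_ isT)[N _ /(_ N.+1 (leqnSn N))] /=.
move/(le_trans (ler_norm _)); apply/negP; rewrite -ltNge.
apply: (@lt_le_trans _ _ 1); first by rewrite invf_lt1 ?ltr1n.
rewrite exprVn ler_pdivlMl ?exprn_gt0// mulr1.
apply: le_trans (spectral_radiusX_ge _ _ n0) _.
by apply: spectral_radius_le => // i j; apply: TC; exact: semigroupX.
Qed.

Lemma coordinate_subspaceP (R : realType) (n : nat) (I : {set 'I_n}) (v : 'cV[R]_n) :
  reflect (forall i, i \notin I -> v i 0 = 0) (v \in coordinate_subspace R I).
Proof.
apply: (iffP idP) => [|v0].
  move=> /coord_span -> i iI; rewrite summxE big1// => k _.
  have kI : (k < size (enum I))%N by rewrite -cardE.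
  rewrite (nth_map i)// !mxE; case: eqP => [ik|]; last by rewrite mulr0.
  by move: iI; rewrite ik -mem_enum mem_nth.
rewrite [v]matrix_sum_delta; apply: memv_suml => i _.
rewrite big_ord1; have [iI|/v0->] := boolP (i \in I); last by rewrite scale0r mem0v.
by apply: memvZ; apply: memv_span; apply: map_f; rewrite mem_enum.
Qed.

Lemma irreducible_entry (R : realType) (n : nat) (T : set 'M[R]_n) a b :
  matrix_semigroup T -> nonneg_family T -> positively_irreducible T ->
  a != b -> exists2 B, T B & 0 < B b a.
Proof.
move=> [_ TM] T0 irr ab; apply: contrapT => noB; apply: irr.
pose I := [set i | (i == a) || `[< exists2 B, T B & 0 < B i a >]]%SET.
have aI : a \in I by rewrite inE eqxx.
have bI : b \notin I.
  by rewrite inE negb_or eq_sym ab; apply/asboolPn.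
exists I; split.
  rewrite card_gt0; apply/andP; split; first by apply/set0Pn; exists a.
  have : (#|I| < #|'I_n|)%N.
    by apply: proper_card; apply/properP; split; [exact: fintype.subset_predT | exists b].
  by rewrite card_ord => In; rewrite -ltnS prednK// (leq_ltn_trans _ In).
move=> A TA v /coordinate_subspaceP vI; apply/coordinate_subspaceP => i iI.
rewrite mxE big1// => k _.
have [kI|/vI->] := boolP (k \in I); last by rewrite mulr0.
suff -> : A i k = 0 by rewrite mul0r.
apply/eqP; rewrite eq_le T0// andbT leNgt; apply/negP => Aik.
move: iI; rewrite inE negb_or => /andP[_ /asboolPn]; apply.
move: kI; rewrite inE => /predU1P[<-|/asboolP[B TB Bka]]; first by exists A.
exists (A *m B); first exact: TM.
rewrite mxE (bigD1 k)//= ltr_pwDl ?mulr_gt0// sumr_ge0// => l _.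
by rewrite mulr_ge0// T0.
Qed.

(* A huge entry [A a b] times a fixed positive entry [B b a] gives [A *m B] a
   huge diagonal entry, hence a spectral radius larger than one. *)
Lemma irreducible_bounded (R : realType) (n : nat) (T : set 'M[R]_n) :
  matrix_semigroup T -> nonneg_family T -> positively_irreducible T ->
  (forall A, T A -> spectral_radius A <= 1) ->
  exists2 C, 0 < C & forall A, T A -> forall i j, `|A i j| <= C.
Proof.
move=> sT T0 irr rT.
have /boolp.choice[M MT] : forall ab : 'I_n * 'I_n, exists M : R,
    forall A, T A -> A ab.1 ab.2 <= M.
  move=> [a b] /=; have [<-|ab] := eqVneq a b.
    exists 1 => A TA; apply: le_trans (rT _ TA).
    by apply: nonneg_diag_le_spectral_radius; exact: T0.
  have [B TB Bba] := irreducible_entry sT T0 irr ab.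
  exists ((B b a)^-1) => A TA; rewrite -[leRHS]mul1r ler_pdivlMr//.
  have TAB : T (A *m B) by exact: sT.2.
  apply: le_trans (rT _ TAB).
  apply: le_trans (nonneg_diag_le_spectral_radius a (T0 _ TAB)).
  by rewrite mxE (bigD1 b)//= lerDl sumr_ge0// => l _; rewrite mulr_ge0// T0.
exists (\big[Order.max/1]_ij M ij).
  by apply: lt_le_trans (bigmax_ge_id _ _ _ _).
move=> A TA i j; rewrite ger0_norm; last exact: T0.
by apply: le_trans (le_bigmax _ _ (i, j)); exact: (MT (i, j)).
Qed.

Lemma bounded_setP (R : realType) (n : nat) (T : set 'M[R]_n) :
  bounded_set T <->
  exists2 C, 0 <= C & forall A, T A -> forall i j, `|A i j| <= C.
Proof.
split.
  move=> [C [_ TC]]; exists (Num.max (C + 1) 0); first by rewrite le_max lexx orbT.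
  move=> A TA i j; apply: le_trans (entry_bound _ _ _) _.
  by rewrite le_max (TC (C + 1))// ltrDl.
move=> [C C0 TC]; exists C; split; first exact: num_real.
move=> K /ltW CK A TA; apply: (le_trans _ CK).
rewrite /= [leLHS]/Num.norm /= mx_normrE; apply: bigmax_le => // -[i j] _.
exact: TC.
Qed.

Lemma jsr_le1_bounded (R : realType) (n : nat) (T : set 'M[R]_n) (C : R) :
  matrix_semigroup T -> 0 <= C ->
  (forall A, T A -> forall i j, `|A i j| <= C) -> jsr_le1 T.
Proof.
move=> sT C0 TC; split; first by apply/bounded_setP; exists C.
rewrite /joint_spectral_radius; set f := fun k : nat => _.
(* [limn] of a divergent sequence is the default point [0]. *)
have [cf|/dvgP ->] := pselect (cvgn f); last exact: lee01.
apply/lee_addgt0Pr => e e0.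
apply: (lime_le cf).
have e1 : 0 < 1 + e by rewrite addr_gt0.
have : (fun k => (1 + e)^-1 ^+ k * C) @ \oo --> 0.
  rewrite -(mul0r C); apply: cvgMl; apply: cvg_expr.
  by rewrite gtr0_norm ?invr_gt0// invf_lt1// ltrDl.
move/cvgr0Pnorm_le => /(_ 1 ltr01) [N _ eN].
exists N.+1 => // -[//|k] /= Nk.
apply: ge_ereal_sup => _ [M MT <-]; rewrite -EFinD lee_fin.
have k0 : (k.+1%:R : R) != 0 by rewrite pnatr_eq0.
have -> : 1 + e = ((1 + e) ^+ k.+1) `^ k.+1%:R^-1.
  by rewrite -powR_mulrn ?ltW// -powRrM divff// powRr1// ltW.
apply: ge0_ler_powR; rewrite ?nnegrE ?invr_ge0 ?ler0n ?normr_ge0//.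
  by rewrite exprn_ge0// ltW.
have := eN k.+1 (ltnW Nk) => /(le_trans (ler_norm _)).
rewrite /= exprVn ler_pdivrMl ?exprn_gt0// mulr1 => CN; apply: (le_trans _ CN).
rewrite [leLHS]/Num.norm /= mx_normrE; apply: bigmax_le => // -[i j] _.
by apply: TC; exact: semigroup_prod.
Qed.

Lemma permutedE (R : realType) (d s : nat) (p : 'I_s -> nat)
    (hd : (\sum_(i < s) p i)%N = d) (sigma : 'S_d) (A : 'M[R]_d) u v :
  permuted hd sigma A u v = A (sigma (cast_ord hd u)) (sigma (cast_ord hd v)).
Proof. by rewrite /permuted castmxE !mxE !esymK. Qed.

Lemma sum_permuted (V : nmodType) (d n : nat) (hd : n = d) (sigma : 'S_d)
    (F : 'I_d -> V) :
  \sum_i F i = \sum_j F (sigma (cast_ord hd j)).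
Proof.
case: d / hd in sigma F *; rewrite (reindex_perm sigma).
by apply: eq_bigr => i _; rewrite cast_ord_id.
Qed.

Lemma permutedM (R : realType) (d s : nat) (p : 'I_s -> nat)
    (hd : (\sum_(i < s) p i)%N = d) (sigma : 'S_d) (A B : 'M[R]_d) :
  permuted hd sigma (A *m B) = permuted hd sigma A *m permuted hd sigma B.
Proof.
apply/matrixP => u v; rewrite permutedE !mxE (sum_permuted hd sigma).
by apply: eq_bigr => j _; rewrite !permutedE.
Qed.

Lemma permuted_eigenvalue (R : realType) (d s : nat) (p : 'I_s -> nat)
    (hd : (\sum_(i < s) p i)%N = d) (sigma : 'S_d) (A : 'M[R]_d) z :
  eigenvalue (complexify (permuted hd sigma A)) z = eigenvalue (complexify A) z.
Proof.
pose f u := sigma (cast_ord hd u).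
pose g k := cast_ord (esym hd) (sigma^-1%g k).
have fK : cancel f g by move=> u; rewrite /g /f permK cast_ordK.
have gK : cancel g f by move=> k; rewrite /g /f cast_ordKV permKV.
apply/eigenvalueP/eigenvalueP => -[v vA /rV0Pn[k vk]].
- exists (\row_i v 0 (g i)).
    apply/rowP => w; rewrite !mxE.
    move/rowP : vA => /(_ (g w)); rewrite !mxE => <-.
    rewrite (sum_permuted hd sigma); apply: eq_bigr => j _.
    by rewrite !mxE permutedE -/(f j) fK -/(f (g w)) gK.
  by apply/rV0Pn; exists (f k); rewrite mxE fK.
- exists (\row_u v 0 (f u)).
    apply/rowP => w; rewrite !mxE.
    move/rowP : vA => /(_ (f w)); rewrite !mxE => <-.
    rewrite (sum_permuted hd sigma); apply: eq_bigr => j _.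
    by rewrite !mxE permutedE.
  by apply/rV0Pn; exists (g k); rewrite mxE gK.
Qed.

Lemma permuted_spectral_radius (R : realType) (d s : nat) (p : 'I_s -> nat)
    (hd : (\sum_(i < s) p i)%N = d) (sigma : 'S_d) (A : 'M[R]_d) :
  spectral_radius (permuted hd sigma A) = spectral_radius A.
Proof.
rewrite /spectral_radius; congr (sup (image _ _)).
by apply/seteqP; split => z /=; rewrite permuted_eigenvalue.
Qed.

Lemma block_eigenvalue (R : realType) (s : nat) (p : 'I_s -> nat)
    (A : 'M[R]_(\sum_(i < s) p i)) z :
  block_upper_triangular A -> eigenvalue (complexify A) z ->
  exists i, eigenvalue (complexify (submxblock A i i)) z.
Proof.
move=> triA /eigenvalueP[v vA v0].
have [i0 vi0] : exists i, submxrow v i != 0.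
  apply: contrapT => all0; move/eqP : v0; apply.
  apply/mxrowP => j; apply/eqP; rewrite submxrow0; apply/negPn/negP => vj.
  by apply: all0; exists j.
have [i vi imin] := @arg_minnP _ i0 (fun i => submxrow v i != 0) (fun i => i : nat) vi0.
exists i; apply/eigenvalueP; exists (submxrow v i) => //.
have := congr1 (fun x => submxrow x i) vA.
rewrite -{1}(submxrowK v) -{1}(submxblockK (complexify A)) mul_mxrow_mxblock mxrowK.
have -> : submxrow (z *: v) i = z *: submxrow v i by apply/matrixP => a b; rewrite !mxE.
move=> <-; rewrite [RHS](bigD1 i)//= [X in _ + X]big1 ?addr0.
  by congr (_ *m _); apply/matrixP => a b; rewrite !mxE.
move=> j ji; have [ij|ij] := ltnP i j.
  have -> : submxblock (complexify A) j i = complexify (submxblock A j i).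
    by apply/matrixP => a b; rewrite !mxE.
  by rewrite triA// map_mx0 mulmx0.
have [->|vj] := eqVneq (submxrow v j) 0; first by rewrite mul0mx.
by move: ji; rewrite -val_eqE /= eqn_leq ij imin.
Qed.

Lemma submxblock_diagM (R : realType) (s : nat) (p : 'I_s -> nat)
    (A B : 'M[R]_(\sum_(i < s) p i)) i :
  block_upper_triangular A -> block_upper_triangular B ->
  submxblock (A *m B) i i = submxblock A i i *m submxblock B i i.
Proof.
move=> triA triB.
rewrite -{1}(submxblockK A) -{1}(submxblockK B) mul_mxblock mxblockK.
rewrite [LHS](bigD1 i)//= [X in _ + X]big1 ?addr0// => j.
rewrite neq_ltn => /orP[ji|ij]; first by rewrite triA// mul0mx.
by rewrite triB// mulmx0.
Qed.

Lemma diag_blockX (R : realType) (s : nat) (p : 'I_s -> nat)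
    (A : 'M[R]_(\sum_(i < s) p i)) k i :
  block_upper_triangular A ->
  block_upper_triangular (A ^+ k) /\ submxblock (A ^+ k) i i = submxblock A i i ^+ k.
Proof.
move=> triA; elim: k => [|k [IH1 IH2]].
  rewrite !expr0; split=> [a b ba|]; apply/matrixP => u v; rewrite !mxE -val_eqE /= tagnat.eq_Rank.
    by rewrite -[a == b]val_eqE gtn_eqF.
  by rewrite eqxx val_eqE.
rewrite !exprS -!mulmxE; split; last by rewrite submxblock_diagM// IH2.
move=> a b ba.
rewrite -{1}(submxblockK A) -(submxblockK (A ^+ k)) mul_mxblock mxblockK.
rewrite [LHS]big1// => j _; have [ja|aj] := ltnP j a; first by rewrite triA// mul0mx.
by rewrite IH1 ?mulmx0// (leq_trans ba).
Qed.

Lemma spectral_radius_le_block (R : realType) (s : nat) (p : 'I_s -> nat)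
    (A : 'M[R]_(\sum_(i < s) p i)) :
  (0 < \sum_(i < s) p i)%N -> block_upper_triangular A ->
  exists i, spectral_radius A <= spectral_radius (submxblock A i i).
Proof.
move=> n0 triA; have [z Az <-] := spectral_radius_attained A n0.
have [i Ai] := block_eigenvalue triA Az.
by exists i; exact: eigenvalue_le_spectral_radius.
Qed.

Lemma spectral_radius_block_le (R : realType) (s : nat) (p : 'I_s -> nat)
    (A : 'M[R]_(\sum_(i < s) p i)) i :
  (0 < p i)%N -> block_upper_triangular A ->
  spectral_radius (submxblock A i i) <= spectral_radius A.
Proof.
move=> pi0 triA; rewrite leNgt; apply/negP => rAi.
have n0 : (0 < \sum_(i < s) p i)%N by rewrite (bigD1 i)//= addn_gt0 pi0.
set t := spectral_radius (submxblock A i i) in rAi.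
have t0 : 0 < t := le_lt_trans (spectral_radius_ge0 A n0) rAi.
have tV0 : 0 < t^-1 by rewrite invr_gt0.
set B := t^-1 *: A.
have triB : block_upper_triangular B.
  move=> a b ba; have -> : submxblock B a b = t^-1 *: submxblock A a b.
    by apply/matrixP => u v; rewrite !mxE.
  by rewrite triA// scaler0.
have rB : spectral_radius B < 1.
  by rewrite spectral_radiusZ// ltr_pdivrMl// mulr1.
have : spectral_radius (submxblock B i i) < 1.
  apply: spectral_radius_lt1 => // u v.
  rewrite [X in X @ \oo --> _](_ : _ =
      fun k => (B ^+ k) (tagnat.Rank i u) (tagnat.Rank i v)).
    exact: powers_cvg0.
  by apply/funext => k; have [_ <-] := diag_blockX k i triB; rewrite !mxE.
have -> : submxblock B i i = t^-1 *: submxblock A i i.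
  by apply/matrixP => u v; rewrite !mxE.
by rewrite spectral_radiusZ// mulVf ?gt_eqF// ltxx.
Qed.

(* Multiplying by a high power of [A j] makes the [j]-th block small, while the
   blocks that are already small stay so because all blocks are bounded. *)
Lemma small_diag_blocks (R : realType) (d s : nat) (p : 'I_s -> nat)
    (D : forall i, 'M[R]_d -> 'M[R]_(p i)) (S : set 'M[R]_d) (C : R)
    (A : 'I_s -> 'M[R]_d) :
  (forall i, 0 < p i)%N -> matrix_semigroup S ->
  (forall i X Y, S X -> S Y -> D i (X *m Y) = D i X *m D i Y) ->
  0 < C -> (forall i X, S X -> forall u v, `|D i X u v| <= C) ->
  (forall j, S (A j)) -> (forall j, spectral_radius (D j (A j)) < 1) ->
  forall k e, (k <= s)%N -> 0 < e ->
  exists2 P, S P & forall i : 'I_s, (i < k)%N -> forall u v, `|D i P u v| <= e.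
Proof.
move=> p0 sS DM C0 SC SA rA; elim=> [|k IH] e ks e0.
  by have [[P SP] _] := sS; exists P.
pose j := Ordinal ks.
pose N := (\max_i p i)%N.
have pN i : (p i <= N)%N by exact: (leq_bigmax i).
have N0 : 0 < N%:R :> R by rewrite ltr0n (leq_trans _ (pN j)).
set e' := e / (N%:R * C).
have e'0 : 0 < e' by rewrite divr_gt0// mulr_gt0.
have eE : N%:R * (C * e') = e by rewrite /e'; field; rewrite !gt_eqF.
have small i a b : a <= C * e' -> b <= a -> (p i)%:R * b <= e.
  move=> ae ba; rewrite -eE.
  apply: (@le_trans _ _ ((p i)%:R * (C * e'))).
    by rewrite ler_wpM2l ?ler0n// (le_trans ba).
  by rewrite ler_wpM2r ?ler_nat// ltW// mulr_gt0.
have [P SP Pe] := IH e' (ltnW ks) e'0.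
have DX m : D j (A j ^+ m.+1) = D j (A j) ^+ m.+1.
  elim: m => [|m IHm]; first by rewrite !expr1.
  by rewrite exprS -mulmxE DM ?IHm -?mulmxE//; exact: semigroupX.
have : \forall m \near \oo, forall uv : 'I_(p j) * 'I_(p j),
    `|(D j (A j) ^+ m) uv.1 uv.2| <= e'.
  apply: filter_forall => -[u v].
  by move/cvgr0Pnorm_le : (powers_cvg0 u v (p0 j) (rA j)) => /(_ _ e'0).
move=> [m _ /(_ m.+1 (leqnSn m))] /=; rewrite -DX => Am.
have SAm : S (A j ^+ m.+1) by exact: semigroupX.
exists (P *m A j ^+ m.+1); first exact: sS.2.
move=> i; rewrite ltnS leq_eqVlt => /predU1P[ik|ik] u v; rewrite DM//.
  have ij : i = j by exact: val_inj.
  subst i.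
  apply: le_trans (mulmx_entry_le (SC j _ SP) (fun u v => Am (u, v)) u v) _.
  exact: small.
apply: le_trans (mulmx_entry_le (Pe i ik) (SC i _ SAm) u v) _.
by apply: (small i (C * e')) => //; rewrite mulrC.
Qed.

Theorem theorem4 (R : realType) (d : nat) (S : set 'M[R]_d)
    (d_gt0 : (0 < d)%N)
    (S_semigroup : matrix_semigroup S)
    (S_closed : closed S)
    (S_nonneg : nonneg_family S)
    (s : nat) (p : 'I_s -> nat)
    (p_gt0 : forall i, (0 < p i)%N)
    (hd : (\sum_(i < s) p i)%N = d)
    (sigma : 'S_d)
    (S_triangular : forall A, S A ->
       block_upper_triangular (permuted hd sigma A))
    (S_irreducible : forall i : 'I_s,
       positively_irreducible (diag_block_family hd sigma S i)) :
  csr S <->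
  exists j : 'I_s, csr (diag_block_family hd sigma S j) /\
    forall i : 'I_s, i != j -> jsr_le1 (diag_block_family hd sigma S i).
Proof.
pose D i A : 'M[R]_(p i) := submxblock (permuted hd sigma A) i i.
have DM i X Y : S X -> S Y -> D i (X *m Y) = D i X *m D i Y.
  by move=> SX SY; rewrite /D permutedM submxblock_diagM//; exact: S_triangular.
have D_semigroup i : matrix_semigroup (diag_block_family hd sigma S i).
  have [[A SA] SM] := S_semigroup; split; first by exists (D i A), A.
  by move=> _ _ [X SX <-] [Y SY <-]; exists (X *m Y); [exact: SM | exact: DM].
have D_nonneg i : nonneg_family (diag_block_family hd sigma S i).
  by move=> _ [X SX <-] u v; rewrite !mxE permutedE; exact: S_nonneg.
have D_le i A : S A -> spectral_radius (D i A) <= spectral_radius A.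
  move=> SA; rewrite -(permuted_spectral_radius hd sigma).
  by apply: spectral_radius_block_le => //; exact: S_triangular.
have le_D A : S A -> exists i, spectral_radius A <= spectral_radius (D i A).
  move=> SA; rewrite -(permuted_spectral_radius hd sigma).
  by apply: spectral_radius_le_block; [rewrite hd | exact: S_triangular].
split=> [S_csr|[j [Dj_csr D_jsr]]].
  have rS := csr_spectral_radius1 d_gt0 S_semigroup S_csr.
  have D_bounded i : exists2 C, 0 < C & forall A, S A -> forall u v, `|D i A u v| <= C.
    have [|C C0 DC] := irreducible_bounded (D_semigroup i) (D_nonneg i) (S_irreducible i).
      by move=> _ [A SA <-]; rewrite -(rS A SA); exact: D_le.
    by exists C => // A SA; apply: DC; exists A.
  suff [j rDj] : exists j, forall A, S A -> 1 <= spectral_radius (D j A).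
    exists j; split.
      exists 1; split=> [|_ [A SA <-]]; first exact: oner_neq0.
      by apply/eqP; rewrite eq_le -{1}(rS A SA) D_le// rDj.
    move=> i _; have [C C0 DC] := D_bounded i.
    apply: (jsr_le1_bounded (D_semigroup i) (ltW C0)) => _ [A SA <-].
    exact: DC.
  apply: contrapT => no_j.
  have /boolp.choice[A SA] : forall j, exists A, S A /\ spectral_radius (D j A) < 1.
    move=> j; apply: contrapT => no_A; apply: no_j; exists j => A SA.
    by rewrite leNgt; apply/negP => rA; apply: no_A; exists A.
  have /boolp.choice[C DC] : forall i, exists C : R,
      forall A, S A -> forall u v, `|D i A u v| <= C.
    by move=> i; have [C _ DC] := D_bounded i; exists C.
  pose C' := \big[Order.max/1]_i C i.
  have C'0 : 0 < C' by apply: lt_le_trans (bigmax_ge_id _ _ _ _).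
  have DC' i X : S X -> forall u v, `|D i X u v| <= C'.
    by move=> SX u v; apply: le_trans (le_bigmax _ _ i); exact: DC.
  have e0 : 0 < (d%:R * 2)^-1 :> R by rewrite invr_gt0 mulr_gt0 ?ltr0n.
  have [P SP Pe] := small_diag_blocks p_gt0 S_semigroup DM C'0 DC'
    (fun j => (SA j).1) (fun j => (SA j).2) (leqnn s) e0.
  have [i rP] := le_D P SP; move: rP; apply/negP; rewrite -ltNge (rS P SP).
  apply: le_lt_trans (spectral_radius_le (p_gt0 i) (Pe i (ltn_ord i))) _.
  apply: (@le_lt_trans _ _ (d%:R * (d%:R * 2)^-1)).
    by rewrite ler_wpM2r ?(ltW e0)// ler_nat -[leqRHS]hd (bigD1 i)//= leq_addr.
  by rewrite invfM mulrA divff ?pnatr_eq0 -?lt0n// mul1r invf_lt1// ltr1n.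
have rDj := csr_spectral_radius1 (p_gt0 j) (D_semigroup j) Dj_csr.
exists 1; split=> [|A SA]; first exact: oner_neq0.
have rDjA : spectral_radius (D j A) = 1 by apply: rDj; exists A.
apply/eqP; rewrite eq_le -{2}rDjA D_le// andbT.
have [i Ai] := le_D A SA; apply: (le_trans Ai).
have [->|ij] := eqVneq i j; first by rewrite rDjA.
have [/bounded_setP[C _ DC] _] := D_jsr i ij.
apply: (bounded_semigroup_spectral_radius (p_gt0 i) (D_semigroup i) DC).
by exists A.
Qed.
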